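(* Let $N\ge1$, let $x_j=\cos\left(\frac{(2j+1)\pi}{2(N+1)}\right)$ for $j=0,\ldots,N$, let $s_i=[x_i,x_{i-1}]$ for $i=1,\ldots,N$, and let $D_N\in\mathbb R^{N\times N}$ be defined by $[D_N]_{ik}=\int_{s_i}T_k'(x)\,dx$, $i,k=1,\ldots,N$. Then the singular values of $D_N$ are \[ \sigma_k(D_N)=\sqrt{2(N+1)}\,\sin\left(\frac{k\pi}{2(N+1)}\right),\quad k=1,\ldots,N. \] Consequently, the spectral condition number of $D_N$ is \[ \kappa_2(D_N)=\cot\left(\frac{\pi}{2(N+1)}\right). \]
   Context: $T_k$ is the Chebyshev polynomial of the first kind of degree $k$, $T_k(\cos\theta)=\cos(k\theta)$. The spectral condition number of a nonsingular matrix is the ratio of its largest to its smallest singular value. *)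

(* Defs.v *)
From HB Require Import structures.
From mathcomp Require Import all_boot all_order all_algebra.
From mathcomp Require Import all_classical all_reals all_analysis.
From mathcomp Require Import polyrcf.

Set Implicit Arguments.
Unset Strict Implicit.
Unset Printing Implicit Defensive.

Import Order.TTheory GRing.Theory Num.Theory.
Import numFieldNormedType.Exports.

Local Open Scope classical_set_scope.
Local Open Scope ring_scope.

Fixpoint chebyshevT (R : comNzRingType) (k : nat) : {poly R} :=
  match k with
  | 0 => 1
  | k'.+1 => match k' with
             | 0 => 'X
             | k''.+1 => 2%:R *: ('X * chebyshevT R k') - chebyshevT R k''
             end
  end.

Lemma chebyshevT_cos (R : realType) (k : nat) (t : R) :
  (chebyshevT R k).[cos t] = cos (k%:R * t).
Proof.
suff: (chebyshevT R k).[cos t] = cos (k%:R * t)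
   /\ (chebyshevT R k.+1).[cos t] = cos (k.+1%:R * t) by case.
elim: k => [|k [IH0 IH1]].
  by rewrite /= hornerC hornerX mul0r mul1r cos0.
split=> //.
have -> : chebyshevT R k.+2 =
  2%:R *: ('X * chebyshevT R k.+1) - chebyshevT R k by [].
rewrite hornerD hornerN hornerZ hornerM hornerX IH0 IH1.
have -> : k.+2%:R * t = k.+1%:R * t + t :> R by rewrite -natr1 mulrDl mul1r.
have -> : k%:R * t = k.+1%:R * t - t :> R by rewrite -natr1 mulrDl mul1r addrK.
by rewrite cosB cosD [cos t * _]mulrC mulr_natl mulr2n opprD addrACA subrr add0r.
Qed.

(* Strictly decreasing in j, for j = 0, ..., N. *)
Definition cheb_node (R : realType) (N j : nat) : R :=
  cos ((2 * j + 1)%:R * pi / (2 * (N + 1))%:R).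

(* Row i and column k (from 0) are row i + 1 and column k + 1 of D_N:
   the integral over s_(i+1) = [x_(i+1), x_i] of the derivative of T_(k+1). *)
Definition DN (R : realType) (N : nat) : 'M[R]_N :=
  \matrix_(i < N, k < N)
    \int[lebesgue_measure]_(x in `[cheb_node R N i.+1, cheb_node R N i])
      (deriv (chebyshevT R k.+1)).[x].

(* Real eigenvalues, each repeated according to its algebraic multiplicity;
   for a symmetric matrix these are all its eigenvalues. *)
Definition real_eigenvalues (R : realType) (n : nat) (A : 'M[R]_n) : seq R :=
  flatten [seq nseq (mup x (char_poly A)) x | x <- rootsR (char_poly A)].

(* With multiplicity and in nondecreasing order. *)
Definition singular_values (R : realType) (n : nat) (A : 'M[R]_n) : seq R :=
  sort <=%R [seq Num.sqrt x | x <- real_eigenvalues (A^T *m A)].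

(* Meaningful for n > 0 and A nonsingular. *)
Definition cond2 (R : realType) (n : nat) (A : 'M[R]_n) : R :=
  last 0 (singular_values A) / head 0 (singular_values A).

Definition cot (R : realType) (x : R) : R := cos x / sin x.

(* Main.v *)
Require Import Defs.
From mathcomp Require Import all_boot all_order all_algebra.
From mathcomp Require Import all_classical all_reals all_analysis.
From mathcomp Require Import polyrcf ring lra zify.

Import Order.TTheory GRing.Theory Num.Theory.
Import numFieldNormedType.Exports.
Local Open Scope ring_scope.

(** With h = pi / (2 (N + 1)), the fundamental theorem of calculus and
    T_k (cos t) = cos (k t) give, in 1-based indices,
    D_N(i, k) = cos ((2 i - 1) k h) - cos ((2 i + 1) k h)
              = 2 sin (2 i k h) sin (k h).
    Hence D_N is a discrete sine transform, whose columns are orthogonal with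
    squared norm (N + 1) / 2, times the diagonal matrix of the 2 sin (k h), and
    D_N^T D_N is diagonal with entries 2 (N + 1) sin^2 (k h).  These increase
    with k, so their square roots are the sorted singular values; the condition
    number is sin (N h) / sin h with N h = pi / 2 - h. *)

(** Two lists are permutations of each other when every [y] occurs equally often in both. Here both
    counts are the multiplicity of [y] as a root of the characteristic polynomial. *)
Lemma real_eigenvalues_split (R : realType) (n : nat) (A : 'M[R]_n) (s : seq R) :
  char_poly A = \prod_(x <- s) ('X - x%:P) -> perm_eq (real_eigenvalues A) s.
Proof.
move=> pE; apply/allP => y _; apply/eqP => /=.
rewrite /real_eigenvalues; set p := char_poly A in pE *.
have p0 : p != 0 by rewrite monic_neq0 // char_poly_monic.
transitivity (mup y p); last by rewrite pE mu_prod_XsubC.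
rewrite count_flatten -map_comp.
under eq_map => x do rewrite /= count_nseq /=.
rewrite sumnE big_map.
under eq_bigr => x _ do rewrite mulnbl.
rewrite -big_mkcond -big_filter.
have memR : (y \in rootsR p) = root p y by rewrite -roots_on_rootsR // in_itv.
(* [rootsR p] has no duplicates, so a root [y] selects exactly one block; a non-root selects none
   and has multiplicity 0. *)
have [ry|nry] := boolP (root p y).
  by rewrite filter_pred1_uniq ?memR ?big_seq1 //; exact: uniq_roots.
rewrite mupNroot // big1_seq // => x /=.
by rewrite mem_filter /= => /andP[/eqP ->]; rewrite memR (negPf nry).
Qed.

(** Dirichlet kernel: [2 sin x cos (2 j x) = sin ((2 j + 1) x) - sin ((2 j - 1) x)]. *)
Lemma sum_cos_telescope (R : realType) (n : nat) (x : R) :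
  2 * sin x * (\sum_(i < n) cos (i.+1%:R * (2 * x))) =
  sin ((2 * n + 1)%:R * x) - sin x.
Proof.
elim: n => [|n IH]; first by rewrite big_ord0 mulr0 mul1r subrr.
rewrite big_ord_recr /= mulrDr IH.
have -> : (2 * n.+1 + 1)%:R * x = n.+1%:R * (2 * x) + x :> R.
  by rewrite natrD natrM; ring.
have -> : (2 * n + 1)%:R * x = n.+1%:R * (2 * x) - x :> R.
  by rewrite natrD natrM -[n.+1%:R]natr1; ring.
by rewrite sinB sinD; ring.
Qed.

(** On the grid [(2 N + 1) x = m pi - x], so the telescoped sum is a multiple of [sin x]. The bounds
    on [m] place [x] strictly between 0 and pi, which allows division by [sin x]. *)
Lemma sum_cos_grid (R : realType) (N m : nat) : (0 < m < 2 * (N + 1))%N ->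
  2 * (\sum_(i < N) cos (i.+1%:R * (2 * (m%:R * (pi / (2 * (N + 1))%:R))))) =
  - 1 - (-1) ^+ m :> R.
Proof.
move=> /andP[m0 mN]; set x : R := (m%:R * _ : R).
have n0 : 0 < (2 * (N + 1))%:R :> R by rewrite ltr0n; lia.
have sx : 0 < sin x.
  apply: sin_gt0_pi; rewrite /x mulrCA pmulr_rgt0 ?pi_gt0 // divr_gt0 //= ?ltr0n //.
  by rewrite gtr_pMr ?pi_gt0 // ltr_pdivrMr // mul1r ltr_nat.
apply: (mulfI (lt0r_neq0 sx)); rewrite mulrA [_ * 2]mulrC sum_cos_telescope.
have -> : (2 * N + 1)%:R * x = - x + pi *+ m.
  rewrite /x -mulr_natl; move: (n0); rewrite !(natrM, natrD) => ?.
  by field; lra.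
by rewrite (alternatingn (@sinDpi R)) sinN; ring.
Qed.

(** Product-to-sum gives cosine sums at the frequencies [k - l] and [k + l]. These have the same
    parity, so the sums cancel unless [k = l]. *)
Lemma sum_sin_grid (R : realType) (N k l : nat) :
  (0 < k <= N)%N -> (0 < l <= N)%N ->
  2 * (\sum_(i < N) sin (i.+1%:R * (2 * (k%:R * (pi / (2 * (N + 1))%:R))))
                   * sin (i.+1%:R * (2 * (l%:R * (pi / (2 * (N + 1))%:R))))) =
  (N + 1)%:R *+ (k == l) :> R.
Proof.
(* The order makes the truncated difference [k - l] a true one. *)
wlog lk : k l / (l <= k)%N => [hwlog|] hk hl.
  have [/hwlog|/ltnW /hwlog] := leqP l k; first exact.
  by move=> /(_ hl hk); rewrite eq_sym => <-; under eq_bigr do rewrite mulrC.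
set h : R := pi / _.
have -> : 2 * (\sum_(i < N) sin (i.+1%:R * (2 * (k%:R * h)))
                           * sin (i.+1%:R * (2 * (l%:R * h)))) =
    (\sum_(i < N) cos (i.+1%:R * (2 * ((k - l)%:R * h))))
    - \sum_(i < N) cos (i.+1%:R * (2 * ((k + l)%:R * h))).
  rewrite mulr_sumr -sumrB; apply: eq_bigr => i _.
  have -> : i.+1%:R * (2 * ((k - l)%:R * h)) =
      i.+1%:R * (2 * (k%:R * h)) - i.+1%:R * (2 * (l%:R * h)).
    by rewrite natrB //; ring.
  have -> : i.+1%:R * (2 * ((k + l)%:R * h)) =
      i.+1%:R * (2 * (k%:R * h)) + i.+1%:R * (2 * (l%:R * h)).
    by rewrite natrD; ring.
  by rewrite cosB cosD; ring.
apply: (@mulfI _ 2); first by rewrite pnatr_eq0.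
rewrite mulrBr (@sum_cos_grid _ _ (k + l)); last by lia.
have [<-|kl] := eqVneq k l.
  (* At frequency 0 every cosine is 1: the doubled sums are [2 N] and [-2]. *)
  under eq_bigr => i _ do rewrite subnn mul0r !mulr0 cos0.
  by rewrite sumr_const card_ord -signr_odd addnn odd_double natrD expr0 mulr1n; ring.
rewrite sum_cos_grid; last by move/eqP: kl; lia.
have -> : (-1 : R) ^+ (k - l) = (-1) ^+ (k + l).
  by rewrite -[LHS]signr_odd -[RHS]signr_odd oddB // -oddD.
by rewrite mulr0n mulr0 subrr.
Qed.

Lemma Rintegral_deriv_horner (R : realType) (p : {poly R}) (a b : R) : a < b ->
  \int[lebesgue_measure]_(x in `[a, b]%classic) (deriv p).[x] = p.[b] - p.[a].
Proof.
move=> ab; rewrite /Rintegral (@continuous_FTC2 _ _ (horner p)) //.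
- by apply: continuous_subspaceT => x; exact: continuous_horner.
- split=> [x _| |]; first exact: derivable_horner.
  + by apply: cvg_at_right_filter; exact: continuous_horner.
  + by apply: cvg_at_left_filter; exact: continuous_horner.
- by move=> x _; rewrite derivE.
Qed.

Lemma DNE (R : realType) (N : nat) (i k : 'I_N) :
  DN R N i k = 2 * sin (i.+1%:R * (2 * (k.+1%:R * (pi / (2 * (N + 1))%:R))))
                 * sin (k.+1%:R * (pi / (2 * (N + 1))%:R)).
Proof.
have iN := ltn_ord i.
have n0 : 0 < (2 * (N + 1))%:R :> R by rewrite ltr0n; lia.
(* Cosine decreases on [[0, pi]], so the nodes are ordered and the integration interval is
   nondegenerate. *)
have node_itv j : (j <= N)%N ->
    (2 * j + 1)%:R * pi / (2 * (N + 1))%:R \in `[0, pi] :> bool.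
  move=> jN; rewrite in_itv /= divr_ge0 ?mulr_ge0 ?pi_ge0 ?ler0n //=.
  by rewrite ler_pdivrMr // mulrC ler_pM2l ?pi_gt0 // ler_nat; lia.
rewrite mxE Rintegral_deriv_horner; last first.
  rewrite ltr_cos ?node_itv //; last exact: ltnW.
  by rewrite ltr_pM2r ?invr_gt0 // ltr_pM2r ?pi_gt0 // ltr_nat; lia.
rewrite !chebyshevT_cos; set h : R := (pi / _).
have -> : k.+1%:R * ((2 * i + 1)%:R * pi / (2 * (N + 1))%:R) =
    i.+1%:R * (2 * (k.+1%:R * h)) - k.+1%:R * h.
  by rewrite /h natrD natrM -[i.+1%:R]natr1; ring.
have -> : k.+1%:R * ((2 * i.+1 + 1)%:R * pi / (2 * (N + 1))%:R) =
    i.+1%:R * (2 * (k.+1%:R * h)) + k.+1%:R * h.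
  by rewrite /h natrD natrM -[i.+1%:R]natr1; ring.
by rewrite cosB cosD; ring.
Qed.

Lemma DN_gram (R : realType) (N : nat) :
  (DN R N)^T *m DN R N = diag_mx (\row_(k < N)
    ((2 * (N + 1))%:R * sin (k.+1%:R * (pi / (2 * (N + 1))%:R)) ^+ 2)).
Proof.
apply/matrixP => k l; rewrite !mxE; set h : R := (pi / _).
under eq_bigr => i _ do rewrite mxE !DNE -/h.
transitivity (2 * sin (k.+1%:R * h) * sin (l.+1%:R * h) *
    (2 * \sum_(i < N) sin (i.+1%:R * (2 * (k.+1%:R * h)))
                   * sin (i.+1%:R * (2 * (l.+1%:R * h))))).
  by rewrite !mulr_sumr; apply: eq_bigr => i _; ring.
rewrite sum_sin_grid ?ltn_ord // eqSS (inj_eq val_inj).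
have [->|_] := eqVneq k l; last by rewrite !mulr0n mulr0.
by rewrite !mulr1n natrM; ring.
Qed.

(** The characteristic polynomial of a diagonal Gram matrix splits over its diagonal entries, and
    [sqrt (s i ^+ 2) = s i] by nonnegativity. *)
Lemma singular_values_gram_diag (R : realType) (n : nat) (A : 'M[R]_n)
    (s : 'I_n -> R) :
  (forall i, 0 <= s i) -> A^T *m A = diag_mx (\row_i s i ^+ 2) ->
  singular_values A = sort <=%R [seq s i | i <- enum 'I_n].
Proof.
move=> s0 gram; apply/perm_sortP => //; first exact: le_total.
- exact: le_trans.
- exact: le_anti.
have -> : [seq s i | i <- enum 'I_n] =
    [seq Num.sqrt x | x <- [seq s i ^+ 2 | i <- enum 'I_n]].
  by rewrite -[RHS]map_comp; apply: eq_map => i; rewrite /= sqrtr_sqr ger0_norm.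
apply: perm_map; apply: real_eigenvalues_split.
rewrite gram char_poly_trig ?is_diag_mx_is_trig ?diag_mx_is_diag //.
by rewrite big_map big_enum; apply: eq_bigr => i _; rewrite !mxE eqxx.
Qed.

Theorem corollary1 (R : realType) (N : nat) (hN : (1 <= N)%N) :
  singular_values (DN R N) =
    [seq Num.sqrt (2 * (N + 1))%:R * sin (k%:R * pi / (2 * (N + 1))%:R)
      | k <- iota 1 N]
  /\ DN R N \in unitmx
  /\ cond2 (DN R N) = cot (pi / (2 * (N + 1))%:R).
Proof.
set f := fun k : nat => _.
have c0 : 0 < (2 * (N + 1))%:R :> R by rewrite ltr0n; lia.
have sc0 : 0 < Num.sqrt (2 * (N + 1))%:R :> R by rewrite sqrtr_gt0.
(* The range includes [k = 0], so that positivity of the later values follows from [f 0 = 0]. *)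
have fmono : {in [pred k | k <= N]%N &, {homo f : x y / (x < y)%N >-> x < y}}.
  have angle k : (k <= N)%N ->
      k%:R * pi / (2 * (N + 1))%:R \in `[- (pi / 2), pi / 2 : R].
    move=> kN; have pi0 := pi_gt0 R; rewrite in_itv /=; apply/andP; split.
      apply: (@le_trans _ _ 0); first by rewrite oppr_le0 divr_ge0 // ltW.
      by rewrite divr_ge0 ?mulr_ge0 ?ler0n ?(ltW pi0).
    rewrite ler_pdivrMr // natrM mulrA divfK ?pnatr_eq0 // mulrC ler_pM2l //.
    by rewrite ler_nat; lia.
  move=> x y /= xN yN xy; rewrite /f ltr_pM2l // ltr_sin ?angle //.
  by rewrite ltr_pM2r ?invr_gt0 // ltr_pM2r ?pi_gt0 // ltr_nat.
have f0 : f 0%N = 0 by rewrite /f !mul0r sin0 mulr0.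
have fpos k : (0 < k <= N)%N -> 0 < f k.
  by move=> /andP[k0 kN]; rewrite -f0 fmono //= inE.
have gram : (DN R N)^T *m DN R N = diag_mx (\row_(k < N) f k.+1 ^+ 2).
  rewrite DN_gram; congr diag_mx; apply/rowP => k; rewrite !mxE.
  by rewrite /f exprMn sqr_sqrtr ?ltW // mulrA.
have svE : singular_values (DN R N) = [seq f k | k <- iota 1 N].
  rewrite (singular_values_gram_diag _ _ _ _ _ gram); last by move=> i; rewrite ltW ?fpos /=.
  have -> : [seq f (nat_of_ord i).+1 | i <- enum 'I_N] = [seq f k | k <- iota 1 N].
    by rewrite -[1%N]addn0 iotaDl -val_enum_ord -!map_comp.
  rewrite sorted_sort //; first exact: le_trans.
  suff: sorted <%O [seq f k | k <- iota 1 N] by rewrite lt_sorted_uniq_le => /andP[].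
  apply: (homo_sorted_in fmono); last exact: iota_ltn_sorted.
  by apply/allP => k; rewrite mem_iota inE; lia.
split=> //; split.
  (* The Gram determinant is the square of [\det (DN R N)]. *)
  have : \det ((DN R N)^T *m DN R N) != 0.
    rewrite gram det_diag; apply/prodf_neq0 => k _.
    by rewrite mxE expf_neq0 // gt_eqF // fpos /=.
  by rewrite unitmxE unitfE det_mulmx det_tr mulf_eq0 orbb.
(* As [N >= 1], the list is nonempty: its head is [f 1], its last entry [f N], and the default 0 is
   not reached. *)
rewrite /cond2 svE -nth0 -nth_last size_map size_iota.
rewrite !(nth_map 0%N) ?size_iota ?nth_iota //; try lia.
rewrite add1n prednK // /f addn0 mul1r -mulf_div divff ?gt_eqF // mul1r /cot.
congr (_ / _).
have -> : N%:R * pi / (2 * (N + 1))%:R = - (pi / (2 * (N + 1))%:R) + pi / 2 :> R.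
  move: (c0); rewrite !(natrM, natrD) => ?; field; lra.
by rewrite sinDpihalf cosN.
Qed.
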